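(* Let $\Gamma$ be a finite Coxeter graph such that every edge label is divisible by $4$. Then every Coxeter group $W$ with $\widehat W\cong\widehat{W_\Gamma}$ is isomorphic to $W_\Gamma$.
   Context: For a finite simplicial graph $\Gamma$ with edge labels $m\colon E(\Gamma)\to\mathbb{N}_{\ge2}$, $W_\Gamma=\langle V(\Gamma)\mid v^2,\ (vw)^{m(\{v,w\})}\text{ for }\{v,w\}\in E(\Gamma)\rangle$. $\widehat{G}$ is profinite completion. *)

(* Defs.v *)
From Stdlib Require Import List.
From mathcomp Require Import all_boot.
Set Implicit Arguments.
Unset Strict Implicit.
Unset Printing Implicit Defensive.

(* Raw group data: a carrier with an equality (setoid), product,       *)
(* inverse and unit.  Groups given by presentations are represented as *)
(* words modulo the congruence generated by the relators.              *)
Record gdata := GData {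
  gcar :> Type;
  geqv : gcar -> gcar -> Prop;
  gmul : gcar -> gcar -> gcar;
  ginv : gcar -> gcar;
  gone : gcar }.

Definition group_iso (G H : gdata) : Prop :=
  exists (f : G -> H) (g : H -> G),
    (forall x y, geqv x y -> geqv (f x) (f y)) /\
    (forall x y, geqv x y -> geqv (g x) (g y)) /\
    (forall x y, geqv (f (gmul x y)) (gmul (f x) (f y))) /\
    (forall x, geqv (g (f x)) x) /\
    (forall y, geqv (f (g y)) y).

Definition fi_normal (G : gdata) (N : G -> Prop) : Prop :=
  (forall x y, geqv x y -> N x -> N y) /\
  N (gone G) /\
  (forall x y, N x -> N y -> N (gmul x y)) /\
  (forall x, N x -> N (ginv x)) /\
  (forall x g, N x -> N (gmul (gmul (ginv g) x) g)) /\
  (exists reps : seq G, forall g, exists r, List.In r reps /\ N (gmul (ginv r) g)).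

(* Profinite completion: the inverse limit of G/N over finite-index    *)
(* normal subgroups N, elements being compatible families of coset     *)
(* representatives x N (meaningful for N finite-index normal).         *)
Definition compatible (G : gdata) (x : (G -> Prop) -> G) : Prop :=
  forall N M, fi_normal N -> fi_normal M -> (forall g, N g -> M g) ->
    M (gmul (ginv (x N)) (x M)).

Definition completion (G : gdata) := {x : (G -> Prop) -> G | compatible x}.

Definition comp_eqv (G : gdata) (x y : completion G) : Prop :=
  forall N, fi_normal N -> N (gmul (ginv (proj1_sig x N)) (proj1_sig y N)).

Definition comp_mul_fun (G : gdata) (x y : completion G) : (G -> Prop) -> G :=
  fun N => gmul (proj1_sig x N) (proj1_sig y N).

(* The open normal subgroups K_N = closure of N = {x | x_N \in N} form a *)
(* neighbourhood basis of the identity of the completion.  A group      *)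
(* homomorphism of topological groups is continuous iff it is continuous *)
(* at the identity, i.e. iff the following holds.                       *)
Definition comp_cont (G H : gdata) (f : completion G -> completion H) : Prop :=
  forall N', fi_normal N' -> exists N, fi_normal N /\
    forall x, N (proj1_sig x N) -> N' (proj1_sig (f x) N').

Definition profinite_iso (G H : gdata) : Prop :=
  exists (f : completion G -> completion H) (g : completion H -> completion G),
    (forall x y, comp_eqv x y -> comp_eqv (f x) (f y)) /\
    (forall x y, comp_eqv x y -> comp_eqv (g x) (g y)) /\
    (forall x y (xy : completion G),
        (forall N, proj1_sig xy N = comp_mul_fun x y N) ->
        forall z : completion H,
        (forall N, proj1_sig z N = comp_mul_fun (f x) (f y) N) ->
        comp_eqv (f xy) z) /\
    (forall x, comp_eqv (g (f x)) x) /\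
    (forall y, comp_eqv (f (g y)) y) /\
    comp_cont f /\ comp_cont g.

(* A finite simplicial edge-labelled graph on vertex set 'I_n is       *)
(* encoded by m : 'I_n -> 'I_n -> nat, symmetric, where for i != j,     *)
(* m i j = 0 means "no edge" and otherwise m i j >= 2 is the label.    *)
(* The diagonal m i i is ignored (no loops).                           *)
Definition coxeter_graph (n : nat) (m : 'I_n -> 'I_n -> nat) : Prop :=
  (forall i j, m i j = m j i) /\
  (forall i j, i != j -> m i j != 0 -> 2 <= m i j).

Definition is_edge (n : nat) (m : 'I_n -> 'I_n -> nat) (i j : 'I_n) : bool :=
  (i != j) && (m i j != 0).

Definition alt_word (n : nat) (i j : 'I_n) (k : nat) : seq 'I_n :=
  flatten (nseq k [:: i; j]).

Inductive cox_eq (n : nat) (m : 'I_n -> 'I_n -> nat) : seq 'I_n -> seq 'I_n -> Prop :=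
| cox_refl u : cox_eq m u u
| cox_sym u v : cox_eq m u v -> cox_eq m v u
| cox_trans u v w : cox_eq m u v -> cox_eq m v w -> cox_eq m u w
| cox_ctx a b u v : cox_eq m u v -> cox_eq m (a ++ u ++ b) (a ++ v ++ b)
| cox_sq i : cox_eq m [:: i; i] [::]
| cox_edge i j : is_edge m i j -> cox_eq m (alt_word i j (m i j)) [::].

(* W_Gamma = < V | v^2, (vw)^m({v,w}) > : words modulo cox_eq, with      *)
(* concatenation as product; rev is the inverse since generators are      *)
(* involutions.                                                         *)
Definition W (n : nat) (m : 'I_n -> 'I_n -> nat) : gdata :=
  @GData (seq 'I_n) (cox_eq m) cat rev [::].

(* Main.v *)
(* A profinite isomorphism yields bijections Hom(W_m, Q) = Hom(W_m', Q), natural in the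
   finite group Q, and only these are used.

   Since 4 divides all labels of m, any two generators v, w of W_m are sent to
   the standard generators of the dihedral group D_4 of order 8 by a quotient
   that kills the other generators.  No involution of D_4 projects to (1, 1) in
   its abelianization (Z/2)^2, so each generator i of W_m' has the class of a
   single generator p(i) of W_m in H_1 = (Z/2)^n.  Transferring the quotients of W_m
   that are dihedral of order 2k, k odd or a power of 2, shows that m(p i, p j) divides
   m'(i, j), i.e. that p induces an epimorphism W_m' -> W_m.  Counting morphisms
   to finite groups, all finite quotients of W_m' factor through it.  A Tits
   representation over a finite field separates the generators of W_m', so p is
   bijective, and dihedral quotients of W_m' then show that p preserves labels. *)
From Stdlib Require Import Classical FunctionalExtensionality.
From HB Require Import structures.
Require Import Defs.
From mathcomp Require Import all_boot all_fingroup all_algebra all_solvable all_field.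
From mathcomp Require Import ring.
Set Implicit Arguments.
Unset Strict Implicit.
Unset Printing Implicit Defensive.
Import GRing.Theory.

Local Open Scope group_scope.

(** * Morphisms to finite groups and the profinite completion *)

(** Such [f] are the homomorphisms from [W m] to [gT], given on generators. The predicate is boolean
    so that they can be collected in a finite set. *)
Definition respects (n : nat) (m : 'I_n -> 'I_n -> nat) (gT : finGroupType)
    (f : 'I_n -> gT) : bool :=
  [forall i, f i * f i == 1] &&
  [forall i, forall j, is_edge m i j ==> ((f i * f j) ^+ m i j == 1)].

Lemma respectsP (n : nat) (m : 'I_n -> 'I_n -> nat) (gT : finGroupType)
    (f : 'I_n -> gT) :
  reflect ((forall i, f i * f i = 1) /\
           (forall i j, is_edge m i j -> (f i * f j) ^+ m i j = 1))
          (respects m f).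
Proof.
apply: (iffP andP) => -[H1 H2]; split.
- by move=> i; apply/eqP; exact: (forallP H1).
- by move=> i j e; apply/eqP; apply: (implyP (forallP (forallP H2 i) j)).
- by apply/forallP=> i; rewrite H1.
- by apply/forallP=> i; apply/forallP=> j; apply/implyP=> e; rewrite H2.
Qed.

Definition evalw (n : nat) (gT : finGroupType) (f : 'I_n -> gT) (w : seq 'I_n) : gT :=
  \prod_(i <- w) f i.

Lemma evalw_cat (n : nat) (gT : finGroupType) (f : 'I_n -> gT) u v :
  evalw f (u ++ v) = evalw f u * evalw f v.
Proof. exact: big_cat. Qed.

Lemma evalw1 (n : nat) (gT : finGroupType) (f : 'I_n -> gT) i :
  evalw f [:: i] = f i.
Proof. exact: big_seq1. Qed.

Lemma evalw_alt (n : nat) (gT : finGroupType) (f : 'I_n -> gT) i j k :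
  evalw f (alt_word i j k) = (f i * f j) ^+ k.
Proof.
elim: k => [|k IH]; first by rewrite /evalw big_nil.
by rewrite expgS -IH -[alt_word _ _ _]/([:: i] ++ [:: j] ++ alt_word i j k)
  !evalw_cat !evalw1 mulgA.
Qed.

Lemma evalw_eq (n : nat) (m : 'I_n -> 'I_n -> nat) (gT : finGroupType)
    (f : 'I_n -> gT) u v :
  respects m f -> cox_eq m u v -> evalw f u = evalw f v.
Proof.
move=> /respectsP [H1 H2]; elim=> {u v} //.
- by move=> u v w _ -> _ ->.
- by move=> a b u v _ IH; rewrite !evalw_cat IH.
- by move=> i; rewrite -[X in evalw _ X]/([:: i] ++ [:: i]) evalw_cat evalw1 H1 /evalw big_nil.
- by move=> i j e; rewrite evalw_alt H2 // /evalw big_nil.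
Qed.

Lemma evalw_rev (n : nat) (m : 'I_n -> 'I_n -> nat) (gT : finGroupType)
    (f : 'I_n -> gT) u :
  respects m f -> evalw f (rev u) = (evalw f u)^-1.
Proof.
move=> /respectsP [H1 _]; elim: u => [|i u IH]; first by rewrite /evalw big_nil invg1.
rewrite rev_cons -cats1 evalw_cat IH evalw1 -cat1s evalw_cat evalw1 invMg.
by congr (_ * _); rewrite -[LHS]mulg1 -(mulgV (f i)) mulgA H1 mul1g.
Qed.

Lemma evalw_morph (n : nat) (gT hT : finGroupType) (h : gT -> hT) (f : 'I_n -> gT) u :
  {morph h : x y / x * y} -> evalw (h \o f) u = h (evalw f u).
Proof.
move=> hM; have h1 : h 1 = 1 by apply: (mulgI (h 1)); rewrite -hM !mulg1.
by rewrite /evalw (big_morph h hM h1).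
Qed.

Lemma evalw_closed (n : nat) (gT : finGroupType) (f : 'I_n -> gT) (P : gT -> Prop) u :
  P 1 -> (forall x y, P x -> P y -> P (x * y)) -> (forall i, P (f i)) -> P (evalw f u).
Proof. by move=> P1 PM Pf; apply: big_ind. Qed.

Definition wker (n : nat) (gT : finGroupType) (f : 'I_n -> gT) : seq 'I_n -> Prop :=
  fun w => evalw f w = 1.

Lemma wker_fi (n : nat) (m : 'I_n -> 'I_n -> nat) (gT : finGroupType) (f : 'I_n -> gT) :
  respects m f -> @fi_normal (W m) (wker f).
Proof.
move=> Hf; rewrite /fi_normal /wker /=; split; [|split; [|split; [|split; [|split]]]].
- by move=> x y /(evalw_eq Hf) ->.
- by rewrite /evalw big_nil.
- by move=> x y Hx Hy; rewrite evalw_cat Hx Hy mulg1.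
- by move=> x Hx; rewrite (evalw_rev _ Hf) Hx invg1.
- by move=> x g Hx; rewrite !evalw_cat Hx mulg1 (evalw_rev _ Hf) mulVg.
(* Finite index: one word is kept for each element of [gT] that is a value of [evalw f]; excluded
   middle decides which elements are. *)
suff [reps Hr] : exists reps : seq (seq 'I_n), forall g, evalw f g \in enum gT ->
    exists r, List.In r reps /\ evalw f r = evalw f g.
  exists reps => g; have [|r [Hr1 Hr2]] := Hr g; first by rewrite mem_enum.
  by exists r; split=> //; rewrite evalw_cat (evalw_rev _ Hf) Hr2 mulVg.
elim: (enum gT) => [|q s [reps IH]]; first by exists [::].
have [[r Hr]|no] := classic (exists r, evalw f r = q).
  exists (r :: reps) => g; rewrite inE => /orP [/eqP Hg|/IH [r' [Hr1 Hr2]]].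
    by exists r; split; [left|rewrite Hr].
  by exists r'; split=> //; right.
exists reps => g; rewrite inE => /orP [/eqP Hg|/IH //].
by case: no; exists g.
Qed.


Lemma W_revl (n : nat) (m : 'I_n -> 'I_n -> nat) u : cox_eq m (rev u ++ u) [::].
Proof.
elim: u => [|i u IH]; first exact: cox_refl.
rewrite rev_cons -cats1 -catA /=.
by apply: cox_trans IH; apply: (cox_ctx (rev u) u (cox_sq m i)).
Qed.

Lemma W_revr (n : nat) (m : 'I_n -> 'I_n -> nat) u : cox_eq m (u ++ rev u) [::].
Proof. by rewrite -{1}(revK u); apply: W_revl. Qed.

Definition completion_unit (n : nat) (m : 'I_n -> 'I_n -> nat) (u : seq 'I_n) :
  completion (W m).
Proof.
exists (fun _ => u) => N M _ [HM [H1 _]] _.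
by apply: HM H1; apply: cox_sym; apply: W_revl.
Defined.

Definition completion_mul (n : nat) (m : 'I_n -> 'I_n -> nat)
  (x y : completion (W m)) : completion (W m).
Proof.
exists (comp_mul_fun x y) => N M HN HM NM.
have [Heq [H1 [HMul [HV [HJ _]]]]] := HM.
have Hx : M (rev (proj1_sig x N) ++ proj1_sig x M) := proj2_sig x N M HN HM NM.
have Hy : M (rev (proj1_sig y N) ++ proj1_sig y M) := proj2_sig y N M HN HM NM.
(* The product of y_N^-1 (x_N^-1 x_M) y_N and y_N^-1 y_M lies in [M] and collapses to (x_N y_N)^-1
   x_M y_M. *)
have Hxy := HMul _ _ (HJ _ (proj1_sig y N) Hx) Hy.
apply: (Heq) Hxy; rewrite /comp_mul_fun /= rev_cat -!catA.
set a := rev (proj1_sig y N); set b := rev _ ; set c := proj1_sig x M.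
have := cox_ctx (a ++ b ++ c) (proj1_sig y M) (W_revr m (proj1_sig y N)).
by rewrite -!catA.
Defined.

Lemma comp_eqv_trans (n : nat) (m : 'I_n -> 'I_n -> nat) (x y z : completion (W m)) :
  comp_eqv x y -> comp_eqv y z -> comp_eqv x z.
Proof.
move=> Hxy Hyz N HN.
have [Heq [_ [HMul _]]] := HN.
apply: (Heq) (HMul _ _ (Hxy N HN) (Hyz N HN)) => /=.
have := cox_ctx (rev (proj1_sig x N)) (proj1_sig z N) (W_revr m (proj1_sig y N)).
by rewrite -!catA.
Qed.

Lemma comp_eqv_sym (n : nat) (m : 'I_n -> 'I_n -> nat) (x y : completion (W m)) :
  comp_eqv x y -> comp_eqv y x.
Proof.
move=> Hxy N HN; have [_ [_ [_ [HV _]]]] := HN.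
by have := HV _ (Hxy N HN); rewrite /= rev_cat revK.
Qed.

Lemma comp_eqv_refl (n : nat) (m : 'I_n -> 'I_n -> nat) (x : completion (W m)) :
  comp_eqv x x.
Proof.
move=> N [Heq [H1 _]]; apply: Heq H1; apply: cox_sym; exact: W_revl.
Qed.

Lemma completion_mul_eqv (n : nat) (m : 'I_n -> 'I_n -> nat) (x x' y y' : completion (W m)) :
  comp_eqv x x' -> comp_eqv y y' ->
  comp_eqv (completion_mul x y) (completion_mul x' y').
Proof.
move=> Hx Hy N HN; have [Heq [H1 [HMul [HV [HJ _]]]]] := HN.
apply: (Heq) (HMul _ _ (HJ _ (proj1_sig y N) (Hx N HN)) (Hy N HN)).
rewrite /= /comp_mul_fun /= rev_cat -!catA.
have := cox_ctx (rev (proj1_sig y N) ++ rev (proj1_sig x N) ++ proj1_sig x' N)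
  (proj1_sig y' N) (W_revr m (proj1_sig y N)).
by rewrite -!catA.
Qed.

Lemma completion_unit_eqv (n : nat) (m : 'I_n -> 'I_n -> nat) u v :
  cox_eq m u v -> comp_eqv (completion_unit m u) (completion_unit m v).
Proof.
move=> uv N [Heq [H1 _]]; apply: Heq H1 => /=; apply: cox_sym.
apply: cox_trans (W_revl m u).
by have := cox_ctx (rev u) [::] (cox_sym uv); rewrite !cats0.
Qed.

(** The continuous extension of [f] to the completion, read off at the coordinate of the kernel of
    [f]. *)
Definition evalc (n : nat) (m : 'I_n -> 'I_n -> nat) (gT : finGroupType)
    (f : 'I_n -> gT) (x : completion (W m)) : gT :=
  evalw f (proj1_sig x (wker f)).

Lemma evalc_eqv (n : nat) (m : 'I_n -> 'I_n -> nat) (gT : finGroupType)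
    (f : 'I_n -> gT) (x y : completion (W m)) :
  respects m f -> comp_eqv x y -> evalc f x = evalc f y.
Proof.
move=> Hf Hxy; have := Hxy _ (wker_fi Hf).
rewrite /wker /= evalw_cat (evalw_rev _ Hf) => H.
by apply: (mulgI (evalc f x)^-1); rewrite mulVg.
Qed.

Definition profinite_morphism (n : nat) (m : 'I_n -> 'I_n -> nat)
    (n' : nat) (m' : 'I_n' -> 'I_n' -> nat)
    (F : completion (W m) -> completion (W m')) : Prop :=
  [/\ forall x y, comp_eqv x y -> comp_eqv (F x) (F y),
      forall x y, comp_eqv (F (completion_mul x y)) (completion_mul (F x) (F y))
    & comp_cont F].

Definition pullback (n : nat) (m : 'I_n -> 'I_n -> nat)
    (n' : nat) (m' : 'I_n' -> 'I_n' -> nat)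
    (F : completion (W m) -> completion (W m')) (gT : finGroupType)
    (f : 'I_n' -> gT) (i : 'I_n) : gT :=
  evalc f (F (completion_unit m [:: i])).

Lemma evalc_F_mul (n : nat) (m : 'I_n -> 'I_n -> nat)
    (n' : nat) (m' : 'I_n' -> 'I_n' -> nat)
    (F : completion (W m) -> completion (W m')) (gT : finGroupType)
    (f : 'I_n' -> gT) x y :
  profinite_morphism F -> respects m' f ->
  evalc f (F (completion_mul x y)) = evalc f (F x) * evalc f (F y).
Proof.
move=> [_ FM _] Hf; rewrite (evalc_eqv Hf (FM x y)).
by rewrite /evalc /= /comp_mul_fun evalw_cat.
Qed.

Lemma evalw_pullback (n : nat) (m : 'I_n -> 'I_n -> nat)
    (n' : nat) (m' : 'I_n' -> 'I_n' -> nat)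
    (F : completion (W m) -> completion (W m')) (gT : finGroupType)
    (f : 'I_n' -> gT) w :
  profinite_morphism F -> respects m' f ->
  evalw (pullback F f) w = evalc f (F (completion_unit m w)).
Proof.
move=> HF Hf; have [FE _ _] := HF.
have Fcat u v : evalc f (F (completion_unit m (u ++ v))) =
    evalc f (F (completion_unit m u)) * evalc f (F (completion_unit m v)).
  rewrite -evalc_F_mul //; apply: evalc_eqv => //; apply: FE.
  exact: comp_eqv_refl.
elim: w => [|i w IH].
  rewrite /evalw big_nil; apply: (mulgI (evalc f (F (completion_unit m [::])))).
  by rewrite -Fcat mulg1.
by rewrite -cat1s evalw_cat Fcat IH evalw1.
Qed.

Lemma pullback_respects (n : nat) (m : 'I_n -> 'I_n -> nat)
    (n' : nat) (m' : 'I_n' -> 'I_n' -> nat)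
    (F : completion (W m) -> completion (W m')) (gT : finGroupType)
    (f : 'I_n' -> gT) :
  profinite_morphism F -> respects m' f -> respects m (pullback F f).
Proof.
move=> HF Hf; have [FE _ _] := HF.
have E u v : cox_eq m u v -> evalw (pullback F f) u = evalw (pullback F f) v.
  move=> uv; rewrite !evalw_pullback //; apply: evalc_eqv => //; apply: FE.
  exact: completion_unit_eqv.
apply/respectsP; split=> [i|i j e].
  have := E _ _ (cox_sq m i).
  by rewrite -[X in evalw _ X]/([:: i] ++ [:: i]) evalw_cat evalw1 /evalw big_nil.
by have := E _ _ (cox_edge e); rewrite evalw_alt /evalw big_nil.
Qed.

(** The word is a coordinate of [F] at the generator. Hence a pullback takes its values in the
    subgroup generated by those of [f]. *)
Lemma pullback_word (n : nat) (m : 'I_n -> 'I_n -> nat)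
    (n' : nat) (m' : 'I_n' -> 'I_n' -> nat)
    (F : completion (W m) -> completion (W m')) (gT : finGroupType)
    (f : 'I_n' -> gT) i :
  exists w, pullback F f i = evalw f w.
Proof. by eexists. Qed.

Lemma evalc_morph (n : nat) (m : 'I_n -> 'I_n -> nat) (gT hT : finGroupType)
    (h : gT -> hT) (f : 'I_n -> gT) (x : completion (W m)) :
  {morph h : x y / x * y} -> respects m f -> respects m (h \o f) ->
  evalc (h \o f) x = h (evalc f x).
Proof.
move=> hM Hf Hhf.
have h1 : h 1 = 1 by apply: (mulgI (h 1)); rewrite -hM !mulg1.
have sub w : wker f w -> wker (h \o f) w by rewrite /wker evalw_morph // => ->.
have := proj2_sig x _ _ (wker_fi Hf) (wker_fi Hhf) sub.
rewrite /wker /= evalw_cat (evalw_rev _ Hhf) => H.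
rewrite /evalc -evalw_morph //.
by apply: (mulgI (evalw (h \o f) (proj1_sig x (wker f)))^-1); rewrite H mulVg.
Qed.

Lemma respects_comp (n : nat) (m : 'I_n -> 'I_n -> nat) (gT hT : finGroupType)
    (h : gT -> hT) (f : 'I_n -> gT) :
  {morph h : x y / x * y} -> respects m f -> respects m (h \o f).
Proof.
move=> hM /respectsP [H1 H2].
have h1 : h 1 = 1 by apply: (mulgI (h 1)); rewrite -hM !mulg1.
have hX x k : h (x ^+ k) = h x ^+ k.
  by elim: k => // k IH; rewrite !expgS hM IH.
apply/respectsP; split=> [i|i j e] /=; first by rewrite -hM H1.
by rewrite -hM -hX H2.
Qed.

Lemma pullback_morph (n : nat) (m : 'I_n -> 'I_n -> nat)
    (n' : nat) (m' : 'I_n' -> 'I_n' -> nat)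
    (F : completion (W m) -> completion (W m')) (gT hT : finGroupType)
    (h : gT -> hT) (f : 'I_n' -> gT) i :
  {morph h : x y / x * y} -> respects m' f ->
  pullback F (h \o f) i = h (pullback F f i).
Proof. by move=> hM Hf; apply: evalc_morph => //; apply: respects_comp. Qed.

(** [G] of a generator is only a limit of words. By continuity of [F] it may be replaced by its
    coordinate at a small enough [N], a genuine word, on which [evalw_pullback] computes. *)
Lemma pullbackK (n : nat) (m : 'I_n -> 'I_n -> nat)
    (n' : nat) (m' : 'I_n' -> 'I_n' -> nat)
    (F : completion (W m) -> completion (W m'))
    (G : completion (W m') -> completion (W m)) (gT : finGroupType)
    (f : 'I_n' -> gT) i :
  profinite_morphism F -> (forall y, comp_eqv (F (G y)) y) -> respects m' f ->
  pullback G (pullback F f) i = f i.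
Proof.
move=> HF FG Hf; have Hf' := pullback_respects HF Hf.
have [_ _ /(_ _ (wker_fi Hf)) [N [HN NF]]] := HF.
have sub w : N w -> wker (pullback F f) w.
  by move=> Nw; rewrite /wker evalw_pullback //; apply: NF.
set y := G (completion_unit m' [:: i]).
have yw : evalw (pullback F f) (proj1_sig y N) = evalc (pullback F f) y.
  have := proj2_sig y _ _ HN (wker_fi Hf') sub.
  rewrite /wker /= evalw_cat (evalw_rev _ Hf') => H.
  by apply: (mulgI (evalw (pullback F f) (proj1_sig y N))^-1); rewrite H mulVg.
rewrite /pullback -/(pullback F f) -/y -yw.
have : evalc f (F (completion_mul (completion_unit m (rev (proj1_sig y N))) y)) = 1.
  by apply: NF; have [Heq [H1 _]] := HN; apply: Heq H1; apply: cox_sym; apply: W_revl.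
rewrite evalc_F_mul // -evalw_pullback // (evalw_rev _ Hf').
rewrite (evalc_eqv Hf (FG _)) /evalc /= evalw1 => H.
by apply: (mulgI (evalw (pullback F f) (proj1_sig y N))^-1); rewrite H mulVg.
Qed.

(* A map Hom(W m, Q) -> Hom(W m', Q), natural in the finite group Q; morphisms
   are represented by the images of the generators. *)
Record hom_transfer (n : nat) (m : 'I_n -> 'I_n -> nat)
    (n' : nat) (m' : 'I_n' -> 'I_n' -> nat)
    (T : forall gT : finGroupType, ('I_n -> gT) -> 'I_n' -> gT) : Prop := {
  transfer_respects : forall (gT : finGroupType) (f : 'I_n -> gT),
    respects m f -> respects m' (T gT f);
  transfer_word : forall (gT : finGroupType) (f : 'I_n -> gT) i,
    exists w, T gT f i = evalw f w;
  transfer_morph : forall (gT hT : finGroupType) (h : gT -> hT) (f : 'I_n -> gT),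
    {morph h : x y / x * y} -> respects m f -> T hT (h \o f) = h \o T gT f }.

Lemma pullback_transfer (n : nat) (m : 'I_n -> 'I_n -> nat)
    (n' : nat) (m' : 'I_n' -> 'I_n' -> nat)
    (F : completion (W m') -> completion (W m)) :
  profinite_morphism F -> hom_transfer m m' (@pullback _ m' _ m F).
Proof.
move=> HF; split.
- by move=> gT f; apply: pullback_respects.
- by move=> gT f i; apply: pullback_word.
- by move=> gT hT h f hM Hf; apply: functional_extensionality => i; apply: pullback_morph.
Qed.

Lemma profinite_iso_transfer (n : nat) (m : 'I_n -> 'I_n -> nat)
    (n' : nat) (m' : 'I_n' -> 'I_n' -> nat) :
  profinite_iso (W m') (W m) ->
  exists (S : forall gT : finGroupType, ('I_n -> gT) -> 'I_n' -> gT)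
         (T : forall gT : finGroupType, ('I_n' -> gT) -> 'I_n -> gT),
    [/\ hom_transfer m m' S, hom_transfer m' m T,
        forall (gT : finGroupType) (f : 'I_n -> gT), respects m f -> T gT (S gT f) = f
      & forall (gT : finGroupType) (f : 'I_n' -> gT), respects m' f -> S gT (T gT f) = f].
Proof.
move=> [F [G [FE [GE [FM [GF [FG [Fc Gc]]]]]]]].
have HF : profinite_morphism F.
  by split=> // x y; apply: FM.
have HG : profinite_morphism G.
  split=> // x y.
  (* [G] is multiplicative as the inverse of the multiplicative map [F]. *)
  apply: comp_eqv_trans (GF (completion_mul (G x) (G y))).
  apply: GE; apply: comp_eqv_sym; case: HF => _ FM' _.
  by apply: comp_eqv_trans (FM' _ _) _; apply: completion_mul_eqv; apply: FG.
exists (@pullback _ m' _ m F), (@pullback _ m _ m' G); split.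
- exact: pullback_transfer.
- exact: pullback_transfer.
- by move=> gT f Hf; apply: functional_extensionality => i; apply: pullbackK.
- by move=> gT f Hf; apply: functional_extensionality => i; apply: pullbackK.
Qed.

(** * Dihedral groups *)

(* The pair (b, x) stands for s^b r^x in the dihedral group of order 2 (k + 1);
   in particular [dih 0] has order 2 and [dih 1] is the Klein four-group. *)
Definition dih (k : nat) : Type := (bool * 'I_k.+1)%type.
HB.instance Definition _ k := Finite.copy (dih k) (bool * 'I_k.+1)%type.

Definition dih_mul k (a b : dih k) : dih k :=
  (a.1 (+) b.1, (if b.1 then - a.2 else a.2) + b.2)%R.
Definition dih_one k : dih k := (false, 0%R).
Definition dih_inv k (a : dih k) : dih k := (a.1, if a.1 then a.2 else - a.2)%R.

Lemma dih_mulA k : associative (@dih_mul k).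
Proof.
move=> [a x] [b y] [c z]; rewrite /dih_mul /= addbA; congr pair.
by case: b; case: c => /=; rewrite ?opprD ?opprK ?addrA.
Qed.

Lemma dih_mul1 k : left_id (@dih_one k) (@dih_mul k).
Proof. by move=> [b x]; rewrite /dih_mul /= oppr0 if_same add0r. Qed.

Lemma dih_mulV k : left_inverse (@dih_one k) (@dih_inv k) (@dih_mul k).
Proof. by move=> [[] x]; rewrite /dih_mul /= addNr. Qed.

HB.instance Definition _ k := Finite_isGroup.Build (dih k)
  (@dih_mulA k) (@dih_mul1 k) (@dih_mulV k).

Lemma dihM k (a b : dih k) :
  a * b = (a.1 (+) b.1, (if b.1 then - a.2 else a.2) + b.2)%R.
Proof. by []. Qed.

Lemma dih1 k : 1 = (false, 0%R) :> dih k.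
Proof. by []. Qed.

Lemma dih_rotX k (x : 'I_k.+1) n : ((false, x) : dih k) ^+ n = (false, x *+ n)%R.
Proof. by elim: n => // n IH; rewrite expgS IH dihM /= mulrS. Qed.

Lemma dih_reflK k (x : 'I_k.+1) : ((true, x) : dih k) * ((true, x) : dih k) = 1.
Proof. by rewrite dihM /= addNr. Qed.

Lemma ord_mulrn_eq0 k (x : 'I_k.+1) n : (x *+ n == 0)%R = (k.+1 %| x * n).
Proof. by rewrite Zp_mulrn -val_eqE. Qed.

Lemma expg_even (gT : finGroupType) (x : gT) n : x * x = 1 -> ~~ odd n -> x ^+ n = 1.
Proof.
by move=> xx /even_halfK <-; rewrite -mul2n expgM expgS expg1 xx expg1n.
Qed.

(** 2 is invertible modulo the odd number [k.+1], so no rotation has order 2. *)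
Lemma dih_odd_involution k (x : dih k) : odd k.+1 -> x * x = 1 -> x.1 = false -> x = 1.
Proof.
case: x => b x ok xx /= b0; subst b.
have /eqP : (x *+ 2)%R = 0%R.
  by rewrite mulr2n; have := congr1 snd xx; rewrite dihM.
rewrite ord_mulrn_eq0 Gauss_dvdl ?coprimen2 // => /dvdnP [[|q]].
  by move=> x0; rewrite dih1; congr pair; apply: val_inj.
by have := ltn_ord x => /[swap] ->; rewrite mulSn ltnNge leq_addr.
Qed.

Lemma dih0P (a : dih 0) : a = (a.1, 0%R).
Proof. by case: a => b x; rewrite (ord1 x). Qed.

Definition sgn k (a : dih k) : dih 0 := (a.1, 0%R).
Definition par k (a : dih k) : dih 0 := (odd a.2, 0%R).

Lemma sgnM k : {morph @sgn k : x y / x * y}.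
Proof. by move=> [a x] [b y]; rewrite [RHS]dih0P. Qed.

Lemma odd_modn_even a d : ~~ odd d -> odd (a %% d) = odd a.
Proof.
by move=> ed; rewrite [in RHS](divn_eq a d) oddD oddM (negbTE ed) andbF.
Qed.

(** Reduction modulo the even number [k.+1] keeps parity, and parity ignores the sign by which a
    reflection twists the exponent. *)
Lemma parM k : odd k -> {morph @par k : x y / x * y}.
Proof.
move=> ok; have ek : ~~ odd k.+1 by rewrite /= ok.
have oddD' (u v : 'I_k.+1) : odd (u + v)%R = odd u (+) odd v.
  by rewrite -oddD -(odd_modn_even (u + v) ek).
have oddN' (u : 'I_k.+1) : odd (- u)%R = odd u.
  have := oddD' u (- u)%R; rewrite subrr /=.
  by case: (odd u); case: (odd (- u)%R).
move=> [a x] [b y]; rewrite [RHS]dih0P dihM /par /=; congr pair.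
by rewrite oddD'; case: b => //=; rewrite oddN'.
Qed.

Lemma dih0_mul (a b : dih 0) : a * b = (a.1 (+) b.1, 0%R).
Proof. by rewrite [LHS]dih0P. Qed.

Lemma dih0_sq (a : dih 0) : a * a = 1.
Proof. by rewrite dih0_mul addbb. Qed.

Definition spar k (a : dih k) : dih 0 := (a.1 (+) odd a.2, 0%R).

Lemma sparM k : odd k -> {morph @spar k : x y / x * y}.
Proof.
move=> ok a b.
have E : odd (a * b).2 = odd a.2 (+) odd b.2 := congr1 fst (parM ok a b).
by rewrite [RHS]dih0_mul /spar /= E addbACA.
Qed.

(** For distinct [v] and [w] these are two reflections whose product is the rotation r, of order
    [k.+1]. *)
Definition dih_pair (n k : nat) (v w u : 'I_n) : dih k :=
  if u == v then ((true, 0%R) : dih k) else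
  if u == w then ((true, inZp 1) : dih k) else (1 : dih k).

(** An edge leaving the pair only imposes an even power of an involution. The edge between [v] and
    [w] imposes a power of r; if it is absent, every [k] is allowed. *)
Lemma dih_pair_respects (n : nat) (m : 'I_n -> 'I_n -> nat) k (v w : 'I_n) :
  (forall i j, m i j = m j i) ->
  (forall i j, is_edge m i j -> ~~ odd (m i j)) ->
  (is_edge m v w -> k.+1 %| m v w) ->
  respects m (@dih_pair n k v w).
Proof.
move=> msym mev kvw.
have sq i : @dih_pair n k v w i * dih_pair k v w i = 1.
  by rewrite /dih_pair; case: eqP => _; [|case: eqP => _]; rewrite ?dih_reflK ?mulg1.
have rotX x i j : is_edge m i j -> (i, j) = (v, w) \/ (j, i) = (v, w) ->
    ((false, x) : dih k) ^+ m i j = 1.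
  move=> e vw; rewrite dih_rotX dih1; congr pair; apply/eqP.
  rewrite ord_mulrn_eq0 dvdn_mull //.
  case: vw => -[? ?]; subst; first exact: kvw.
  by rewrite msym; apply: kvw; rewrite /is_edge eq_sym msym.
apply/respectsP; split=> // i j e.
have ij : i != j by case/andP: e.
have [Ei|Ni] := boolP ((i == v) || (i == w)); last first.
  rewrite [dih_pair _ _ _ i]/dih_pair; move: Ni; rewrite negb_or => /andP [/negbTE -> /negbTE ->].
  by rewrite mul1g expg_even // mev.
have [Ej|Nj] := boolP ((j == v) || (j == w)); last first.
  rewrite [dih_pair _ _ _ j]/dih_pair; move: Nj; rewrite negb_or => /andP [/negbTE -> /negbTE ->].
  by rewrite mulg1 expg_even // mev.
have vw : (i, j) = (v, w) \/ (j, i) = (v, w).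
  by case/orP: Ei => /eqP Ei; case/orP: Ej => /eqP Ej; subst; auto;
    rewrite eqxx in ij.
have refl u : (u == v) || (u == w) -> (dih_pair k v w u).1.
  by rewrite /dih_pair; case: eqP => //= _ ->.
have := rotX (dih_pair k v w i * dih_pair k v w j).2 _ _ e vw.
by rewrite -[RHS]/1 => <-; congr (_ ^+ _); rewrite dihM /= !refl.
Qed.

(** * Comparing the generators of two Coxeter groups *)

Section ClassMap.
Variables (n : nat) (m : 'I_n -> 'I_n -> nat) (n' : nat) (m' : 'I_n' -> 'I_n' -> nat).
Variables (S : forall gT : finGroupType, ('I_n -> gT) -> 'I_n' -> gT)
          (T : forall gT : finGroupType, ('I_n' -> gT) -> 'I_n -> gT).
Hypothesis msym : forall i j, m i j = m j i.
Hypothesis m4 : forall i j, is_edge m i j -> 4 %| m i j.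
Hypothesis Str : hom_transfer m m' S.
Hypothesis Ttr : hom_transfer m' m T.
Hypothesis SK : forall (gT : finGroupType) (f : 'I_n -> gT), respects m f -> T (S f) = f.
Hypothesis TK : forall (gT : finGroupType) (f : 'I_n' -> gT), respects m' f -> S (T f) = f.

Lemma m_even i j : is_edge m i j -> ~~ odd (m i j).
Proof. by move/m4/(dvdn_trans (isT : 2 %| 4)); rewrite dvdn2. Qed.

Lemma respects_dih0 (y : 'I_n -> dih 0) : respects m y.
Proof.
apply/respectsP; split=> [i|i j /m_even e]; first exact: dih0_sq.
by apply: expg_even e; apply: dih0_sq.
Qed.

(** Naturality for the characters [sgn], [par] and [spar] of the Klein four-group [dih 1], applied
    to the morphism with components [y] and [z]. *)
Lemma transfer_dih0M (y z : 'I_n -> dih 0) i :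
  S (fun u => y u * z u) i = S y i * S z i.
Proof.
pose f u : dih 1 := ((y u).1, inZp (z u).1).
have Hf : respects m f.
  have sq (a : dih 1) : a * a = 1.
    case: a => a x; rewrite dihM addbb dih1; congr pair; case: a => /=.
      by rewrite addNr.
    by rewrite -mulr2n; apply/eqP; rewrite ord_mulrn_eq0 dvdn_mull.
  apply/respectsP; split=> [u|u v /m_even e]; first exact: sq.
  exact: expg_even (sq _) e.
have Ey : y = @sgn 1 \o f.
  by apply: functional_extensionality => u; rewrite [LHS]dih0P.
have Ez : z = @par 1 \o f.
  by apply: functional_extensionality => u; rewrite [LHS]dih0P /par /=; case: (z u).1.
have Eyz : (fun u => y u * z u) = @spar 1 \o f.
  by apply: functional_extensionality => u; rewrite dih0_mul /spar /=; case: (z u).1.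
rewrite Eyz (transfer_morph Str (@sparM 1 isT) Hf) {1}Ey {1}Ez.
rewrite (transfer_morph Str (@sgnM 1) Hf) (transfer_morph Str (@parM 1 isT) Hf).
by rewrite dih0_mul.
Qed.

Lemma transfer_cst1 (gT : finGroupType) i : S (fun _ => 1 : gT) i = 1.
Proof.
have [w ->] := transfer_word Str (fun _ => 1 : gT) i.
by rewrite /evalw big1.
Qed.

Lemma transfer_dih0_prod (I : Type) (r : seq I) (F : I -> 'I_n -> dih 0) i :
  S (fun u => \prod_(v <- r) F v u) i = \prod_(v <- r) S (F v) i.
Proof.
elim: r => [|v r IH].
  rewrite big_nil -[RHS](transfer_cst1 _ i); congr (S _ i).
  by apply: functional_extensionality => u; rewrite big_nil.
rewrite big_cons -IH -transfer_dih0M; congr (S _ i).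
by apply: functional_extensionality => u; rewrite big_cons.
Qed.

Let ind (v u : 'I_n) : dih 0 := (u == v, 0%R).

(* In D_4 no involution has nontrivial image under both coordinates of the
   abelianization. *)
Lemma transfer_ind_disjoint v w i :
  v != w -> (S (ind v) i).1 -> (S (ind w) i).1 = false.
Proof.
move=> vw; pose f := @dih_pair n 3 v w.
have Hf : respects m f.
  by apply: dih_pair_respects => //; [exact: m_even|move/m4].
have Ev : ind v = @spar 3 \o f.
  apply: functional_extensionality => u; rewrite /= /spar /ind /f /dih_pair.
  by case: eqP => //= _; case: eqP.
have Ew : ind w = @par 3 \o f.
  apply: functional_extensionality => u; rewrite /= /par /ind /f /dih_pair.
  by case: (u =P v) => [->|_]; [rewrite (negbTE vw)|case: eqP].
rewrite Ev Ew (transfer_morph Str (@sparM 3 isT) Hf) (transfer_morph Str (@parM 3 isT) Hf) /=.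
have /respectsP [/(_ i) sq _] := transfer_respects Str Hf.
case: (S f i) sq => b x sq /=.
(* If both characters were nontrivial, the value would be a rotation with odd exponent, which has
   order 4 in D_4. *)
case ox: (odd x); rewrite ?addbT // => /negbTE b0; move: sq; rewrite b0 dihM => /(congr1 snd) /= /eqP.
rewrite -mulr2n ord_mulrn_eq0 => /dvdnP [q Hq].
have : odd (x * 2 %/ 2) = odd (q * 2 * 2 %/ 2) by rewrite Hq -mulnA.
by rewrite !mulnK // ox oddM andbF.
Qed.

(** On Hom(-, Z/2) the map [S] is a linear bijection. Each row of its matrix has at most one nonzero
    entry by [transfer_ind_disjoint] and at least one by surjectivity; by injectivity no column
    vanishes. *)
Lemma class_map :
  exists p : 'I_n' -> 'I_n, (forall (y : 'I_n -> dih 0) i, S y i = y (p i)) /\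
    forall v, exists i, p i = v.
Proof.
pose F (y : 'I_n -> dih 0) v := if (y v).1 then ind v else fun _ => 1.
have yE y : y = (fun u => \prod_v F y v u).
  apply: functional_extensionality => u.
  rewrite (eq_bigr (fun v => if u == v then y v else 1)).
    by rewrite -big_mkcond /= (eq_bigl _ _ (eq_sym u)) big_pred1_eq.
  move=> v _; rewrite /F [y v]dih0P /=; case: (y v).1 => /=.
    by rewrite /ind; case: eqP.
  by rewrite if_same.
have SF y v i : S (F y v) i = if (y v).1 then S (ind v) i else 1.
  by rewrite /F; case: (y v).1 => //; apply: transfer_cst1.
have /fin_all_exists [p Hp] : forall i, exists v, (S (ind v) i).1.
  move=> i; apply: NNPP => no.
  (* A character nontrivial on every generator; it could not be in the image of [S] if all
     [S (ind v)] vanished at [i]. *)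
  pose c (_ : 'I_n') : dih 0 := (true, 0%R).
  have Hc : respects m' c.
    apply/respectsP; split=> [j|j k _]; first by rewrite dih0_sq.
    by rewrite dih0_sq expg1n.
  have : S (T c) i = (true, 0%R) by rewrite TK.
  rewrite (yE (T c)) transfer_dih0_prod big1 // => v _; rewrite SF; case: ifP => // _.
  by rewrite [LHS]dih0P; case E: (S (ind v) i).1 => //; case: no; exists v.
exists p; have Sp (y : 'I_n -> dih 0) i : S y i = y (p i).
  rewrite {1}(yE y) transfer_dih0_prod.
  rewrite (eq_bigr (fun v => if v == p i then y v else 1)).
    by rewrite -big_mkcond /= big_pred1_eq.
  move=> v _; rewrite SF [S _ _]dih0P [y v]dih0P /=.
  case: eqP => [->|/eqP vp]; first by rewrite Hp; case: (y (p i)).1.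
  by rewrite (transfer_ind_disjoint _ (Hp i)) 1?eq_sym //; case: (y v).1.
split=> // v; apply: NNPP => no.
have S1 : S (ind v) = fun _ => 1.
  apply: functional_extensionality => i; rewrite Sp /ind; case: eqP => // E.
  by case: no; exists i.
have := congr1 (fun f => f v) (SK (respects_dih0 (ind v))); rewrite S1.
have [w ->] := transfer_word Ttr (fun _ => 1 : dih 0) v.
by rewrite /evalw big1 // /ind eqxx.
Qed.

Variable p : 'I_n' -> 'I_n.
Hypothesis Sp : forall (y : 'I_n -> dih 0) i, S y i = y (p i).

Lemma transfer_fst k (f : 'I_n -> dih k) i :
  respects m f -> (S f i).1 = (f (p i)).1.
Proof.
move=> Hf; have := Sp (@sgn k \o f) i.
by rewrite (transfer_morph Str (@sgnM k) Hf) => /(congr1 fst).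
Qed.

(** An odd label makes the two generators conjugate, so the character [S (ind (p i))] cannot tell
    them apart. *)
Lemma odd_edge i j : is_edge m' i j -> odd (m' i j) -> p i = p j.
Proof.
move=> e o; apply/eqP; apply: contraT => ne.
have Hy := transfer_respects Str (respects_dih0 (ind (p i))).
have /respectsP [_ /(_ i j e)] := Hy.
rewrite !Sp /ind eqxx (eq_sym (p j)) (negbTE ne) mulg1 -(odd_double_half (m' i j)) o.
by rewrite expgS -mul2n expgM expgS expg1 dih0_sq expg1n mulg1.
Qed.

(* Restricting [g] to the fibre over [v] and transferring back to [W m] gives a
   morphism whose only nontrivial generator is [v], so that its image, which
   is also the image of the restriction, has order 2. *)
Lemma transfer_fibre_const k (g : 'I_n' -> dih k) i j :
  odd k.+1 -> respects m' g -> (forall u, p u = p i -> (g u).1) ->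
  p j = p i -> g j = g i.
Proof.
move=> ok /respectsP [gsq gedge] g1 pji; set v := p i in g1 pji.
pose g' u := if p u == v then g u else 1.
have sq u : g' u * g' u = 1 by rewrite /g'; case: ifP; rewrite ?mulg1.
have Hg' : respects m' g'.
  apply/respectsP; split=> // a b e.
  (* By [odd_edge] an odd edge stays within one fibre; across fibres the relation is an even power
     of an involution. *)
  have [o|ev] := boolP (odd (m' a b)).
    rewrite /g' (odd_edge e o); case: ifP => _; first exact: gedge.
    by rewrite mulg1 expg1n.
  rewrite {1}/g'; case: ifP => _; last by rewrite mul1g expg_even.
  rewrite /g'; case: ifP => _; first exact: gedge.
  by rewrite mulg1 expg_even.
have /respectsP [hsq _] := transfer_respects Ttr Hg'.
have Th : @sgn k \o T g' = ind v.
  rewrite -(transfer_morph Ttr (@sgnM k) Hg') -(SK (respects_dih0 (ind v))).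
  congr (T _); apply: functional_extensionality => u; rewrite Sp /ind /g' /=.
  by case: eqP => [/g1|//]; rewrite /sgn => ->.
have h1 u : u != v -> T g' u = 1.
  move=> /negbTE uv; apply: dih_odd_involution ok (hsq u) _.
  by have := congr1 (fun f => (f u).1) Th; rewrite /ind uv.
have im u : p u = v -> g u = T g' v.
  move=> pu; have : g' u = 1 \/ g' u = T g' v.
    rewrite -[g'](TK Hg'); have [w ->] := transfer_word Str (T g') u.
    rewrite TK //; apply: (@evalw_closed _ _ _ (fun x => x = 1 \/ x = T g' v)); first by left.
      by move=> x y [->|->] [->|->]; rewrite ?mulg1 ?mul1g ?hsq; auto.
    by move=> x; have [->|/h1] := eqVneq x v; auto.
  rewrite /g' pu eqxx => -[E|//]; by have := g1 _ pu; rewrite E.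
by rewrite !im.
Qed.

(** [S f] is constant on the fibres of [p i] and [p j] and trivial elsewhere, so its image is
    generated by [g i] and [g j]. This is also the image of [f], whose rotation of order [k.+1] is
    therefore killed by [m' i j]. *)
Lemma transfer_dvd_odd k i j :
  odd k.+1 -> p i != p j -> is_edge m' i j ->
  (is_edge m (p i) (p j) -> k.+1 %| m (p i) (p j)) -> k.+1 %| m' i j.
Proof.
move=> ok pij e dv.
pose f := @dih_pair n k (p i) (p j).
have Hf : respects m f by apply: dih_pair_respects => //; exact: m_even.
have Hg := transfer_respects Str Hf.
set g := S f in Hg; have /respectsP [gsq gedge] := Hg.
have g1 u : (g u).1 = (p u == p i) || (p u == p j).
  by rewrite transfer_fst // /f /dih_pair; do 2?case: eqP.
(* The subgroup generated by the reflection [g i] and the rotations killed by [m' i j]. *)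
pose P (x : dih k) := ((x.2 - (if x.1 then (g i).2 else 0)) *+ m' i j = 0)%R.
have PM x y : P x -> P y -> P (x * y).
  rewrite /P dihM; case: x => b x; case: y => c y /=; set a := (g i).2.
  case: b; case: c; rewrite /= ?subr0 => Hx Hy.
  - have -> : (- x + y = (y - a) - (x - a))%R.
      by rewrite opprB addrA subrK addrC.
    by rewrite mulrnBl Hx Hy subr0.
  - by rewrite addrAC mulrnDl Hx Hy addr0.
  - by rewrite -addrA mulrnDl mulNrn Hx Hy oppr0 add0r.
  - by rewrite mulrnDl Hx Hy addr0.
have Pg u : P (g u).
  have [pu|pui] := eqVneq (p u) (p i).
    rewrite (@transfer_fibre_const k g i u) // => [|x px].
      by rewrite /P g1 eqxx subrr mul0rn.
    by rewrite g1 px eqxx.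
  have [pu|puj] := eqVneq (p u) (p j).
    rewrite (@transfer_fibre_const k g j u) // => [|x px]; last first.
      by rewrite g1 px eqxx orbT.
    have := gedge _ _ e; rewrite dihM !g1 !eqxx orbT /= dih_rotX => /(congr1 snd) /=.
    by rewrite /P g1 eqxx orbT addrC.
  rewrite (dih_odd_involution ok (gsq u)) /P ?subr0 ?mul0rn //.
  by rewrite g1 (negbTE pui) (negbTE puj).
have Pf u : P (f u).
  rewrite -(SK Hf) -/g; have [w ->] := transfer_word Ttr g u.
  by apply: (@evalw_closed _ _ _ P) => //; rewrite /P subr0 mul0rn.
have := Pf (p i); have := Pf (p j); rewrite /P /f /dih_pair eqxx (eq_sym (p j)) (negbTE pij) eqxx /=.
move=> Hj Hi; have : ((inZp 1 : 'I_k.+1) *+ m' i j = 0)%R.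
  have -> : inZp 1 = ((inZp 1 - (g i).2) - (0 - (g i).2))%R.
    by rewrite sub0r opprK subrK.
  by rewrite mulrnBl Hi Hj subr0.
by move/eqP; rewrite ord_mulrn_eq0 /= /dvdn modnMml mul1n.
Qed.

(** The characters show that [g i * g j] is a rotation with odd exponent; modulo a power of 2 this
    is a unit, so the rotation has full order. *)
Lemma transfer_dvd_two a i j :
  p i != p j -> is_edge m' i j ->
  (is_edge m (p i) (p j) -> (2 ^ a.+1)%N %| m (p i) (p j)) -> (2 ^ a.+1)%N %| m' i j.
Proof.
move=> pij e; have [k Ek] : exists k, (2 ^ a.+1)%N = k.+1.
  by exists (2 ^ a.+1)%N.-1; rewrite prednK // expn_gt0.
have ok : odd k by have := congr1 odd Ek; rewrite expnS oddM /=; case: odd.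
rewrite Ek => dv; pose f := @dih_pair n k (p i) (p j).
have Hf : respects m f by apply: dih_pair_respects => //; exact: m_even.
have /respectsP [_ /(_ i j e)] := transfer_respects Str Hf.
set g := S f => gij.
have gpar u : odd (g u).2 = odd (f (p u)).2.
  have := Sp (@par k \o f) u.
  by rewrite (transfer_morph Str (parM ok) Hf) => /(congr1 fst).
have zodd : odd (g i * g j).2.
  have : odd (g i * g j).2 = odd (g i).2 (+) odd (g j).2 := congr1 fst (parM ok _ _).
  rewrite !gpar => ->; rewrite /f /dih_pair eqxx (eq_sym (p j)) (negbTE pij) eqxx /=.
  by rewrite odd_modn_even //= ok.
have z1 : (g i * g j).1 = false.
  by rewrite dihM /= !transfer_fst // /f /dih_pair eqxx (eq_sym (p j)) (negbTE pij) eqxx.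
move: gij zodd z1; case: (g i * g j) => b z /= gij zodd b0; move: gij; rewrite b0 dih_rotX.
move/(congr1 snd)/eqP; rewrite /= ord_mulrn_eq0; move: (nat_of_ord z) zodd => c codd; rewrite -Ek Gauss_dvdr //.
by rewrite coprime_sym coprimeXr // coprimen2.
Qed.

Lemma transfer_dvd i j :
  p i != p j -> is_edge m' i j ->
  is_edge m (p i) (p j) /\ m (p i) (p j) %| m' i j.
Proof.
move=> pij e; have m'0 : 0 < m' i j by case/andP: e; rewrite lt0n.
have [ep|nep] := boolP (is_edge m (p i) (p j)); last first.
  (* Without an edge in [m] every power of 2 would divide [m' i j], even one exceeding it. *)
  have /dvdn_leq : (2 ^ (m' i j).+1)%N %| m' i j.
    by apply: transfer_dvd_two => //; rewrite (negbTE nep).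
  by move=> /(_ m'0); rewrite leqNgt (ltn_trans (ltnSn _)) // ltn_expl.
split=> //; have mp : 0 < m (p i) (p j) by case/andP: ep; rewrite lt0n.
rewrite -(partnC 2 mp) Gauss_dvd ?coprime_partC //; apply/andP; split.
  rewrite p_part; have : 0 < logn 2 (m (p i) (p j)).
    by rewrite logn_gt0 mem_primes mp /=; move/m_even: ep; rewrite dvdn2.
  case E: (logn _ _) => [//|a] _; apply: transfer_dvd_two => // _.
  by rewrite -E pfactor_dvdnn.
have [k Ek] : exists k, ((m (p i) (p j))`_2^')%N = k.+1.
  by exists ((m (p i) (p j))`_2^')%N.-1; rewrite prednK // part_gt0.
rewrite Ek; apply: transfer_dvd_odd => //; last by rewrite -Ek dvdn_part.
by rewrite -Ek odd_2'nat part_pnat.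
Qed.

Lemma respects_class_map (gT : finGroupType) (f : 'I_n -> gT) :
  respects m f -> respects m' (f \o p).
Proof.
move=> /respectsP [fsq fedge]; apply/respectsP; split=> [i|i j e] /=; first exact: fsq.
have [->|pij] := eqVneq (p i) (p j); first by rewrite fsq expg1n.
have [e' /dvdnP [q ->]] := transfer_dvd pij e.
by rewrite mulnC expgM fedge // expg1n.
Qed.

Hypothesis psurj : forall v, exists i, p i = v.

(* Composition with [p] embeds Hom(W m, gT) into Hom(W m', gT), and the transfers
   show that these finite sets have the same cardinality. *)
Lemma class_map_factor (gT : finGroupType) (h : 'I_n' -> gT) :
  respects m' h -> exists2 f, respects m f & h = f \o p.
Proof.
move=> Hh.
pose A := [set f : {ffun 'I_n -> gT} | respects m f].
(* Composition with [p] followed by [T] is an injective self-map of the finite set [A], hence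
   onto. *)
pose t (f : {ffun 'I_n -> gT}) := [ffun v => T (f \o p) v].
have tE f : t f = T (f \o p) :> ('I_n -> gT).
  by apply: functional_extensionality => v; rewrite ffunE.
have inj : {in A &, injective t}.
  move=> f1 f2; rewrite !inE => /respects_class_map H1 /respects_class_map H2 E.
  have {}E : f1 \o p = f2 \o p by rewrite -(TK H1) -(TK H2) -!tE E.
  by apply/ffunP => v; have [i <-] := psurj v; exact: (congr1 (fun f => f i) E).
have tA : t @: A = A.
  apply/eqP; rewrite eqEcard card_in_imset // leqnn andbT.
  apply/subsetP => _ /imsetP [f fA ->]; rewrite inE in fA; rewrite inE tE.
  by have Hfp := respects_class_map fA; have := transfer_respects Ttr Hfp.
have : finfun (T h) \in t @: A.
  have Eh : finfun (T h) = T h :> ('I_n -> gT).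
    by apply: functional_extensionality => v; rewrite ffunE.
  by rewrite tA inE Eh; have := transfer_respects Ttr Hh.
case/imsetP => f; rewrite inE => Hf E; exists f => //.
rewrite -(TK Hh) -(TK (respects_class_map Hf)) -tE -E; congr (S _).
by apply: functional_extensionality => v; rewrite ffunE.
Qed.

End ClassMap.

Local Close Scope group_scope.

(** * A reflection representation over a finite field *)

Section Reflections.
Local Open Scope ring_scope.
Variables (F : finFieldType) (n : nat) (c : 'I_n -> 'I_n -> F).
Hypothesis cii : forall i, c i i = 2%:R.
Hypothesis csym : forall i j, c i j = c j i.
Let V := {ffun 'I_n -> F}.
(** B(x, e_k) for the symmetric bilinear form B with Gram matrix [c]; [brefl k] is then the
    reflection sending x to x - B(x, e_k) e_k. *)
Definition bform (x : V) (k : 'I_n) : F := \sum_l x l * c l k.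
Definition bshift (x : V) (k : 'I_n) (a : F) : V := [ffun l => x l + (if l == k then a else 0)].
Definition brefl (k : 'I_n) (x : V) : V := bshift x k (- bform x k).

Lemma bform_shift x k a l : bform (bshift x k a) l = bform x l + a * c k l.
Proof.
rewrite /bform (eq_bigr (fun i => x i * c i l + (if i == k then a * c k l else 0))).
  by rewrite big_split /= -big_mkcond big_pred1_eq.
by move=> i _; rewrite ffunE mulrDl; case: eqP => [->|_] //; rewrite mul0r.
Qed.

Lemma brefl_form k x l : bform (brefl k x) l = bform x l - bform x k * c k l.
Proof. by rewrite bform_shift mulNr. Qed.

Lemma breflE k x l : brefl k x l = x l - (if l == k then bform x k else 0).
Proof. by rewrite ffunE; case: eqP; rewrite ?oppr0. Qed.

Lemma brefl_invol k : involutive (brefl k).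
Proof.
move=> x; rewrite {1}/brefl brefl_form cii; apply/ffunP => l; rewrite !ffunE.
by case: eqP => _; ring.
Qed.

Definition srefl k : {perm V} := perm (inv_inj (brefl_invol k)).

Lemma srefl_sq k : (srefl k * srefl k = 1)%g.
Proof. by apply/permP => x; rewrite permM !permE brefl_invol. Qed.

Lemma srefl_commute i j : i != j -> c i j = 0 -> ((srefl i * srefl j) ^+ 2 = 1)%g.
Proof.
move=> ij cij; apply/permP => x; rewrite expgS expg1 !permM !permE.
have cji : c j i = 0 by rewrite csym.
apply/ffunP => l; rewrite !breflE !brefl_form cij cji !cii.
by case: (eqVneq l i) => [->|_]; rewrite ?(negbTE ij); [|case: eqP => _]; ring.
Qed.

(* With [c i j = h + h^-1] the forms [B(., e_j) - h^(+-1) B(., e_i)] are eigenvectors of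
   the rotation for the eigenvalues [h^(+-2)].  Hence its power [r] fixes them; since
   it moves vectors only along the nondegenerate plane of [e_i] and [e_j], it is
   the identity. *)
Lemma srefl_rotation i j (h : F) r :
  i != j -> h != 0 -> h ^+ 2 != 1 -> h ^+ r = 1 -> c i j = h + h^-1 ->
  ((srefl i * srefl j) ^+ r = 1)%g.
Proof.
move=> ij h0 h21 hr cij; have cji : c j i = h + h^-1 by rewrite csym.
set g := (srefl i * srefl j)%g.
have gE x : g x = brefl j (brefl i x) by rewrite permM !permE.
pose th (a : F) (x : V) := bform x j - a * bform x i.
have thg a x : a != 0 -> h + h^-1 = a + a^-1 -> th a (g x) = a ^+ 2 * th a x.
  move=> a0 E; rewrite /th gE !brefl_form !cii cij cji E; field.
  by [].
have thX a x k : a != 0 -> h + h^-1 = a + a^-1 -> th a ((g ^+ k)%g x) = a ^+ (2 * k) * th a x.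
  move=> a0 E; elim: k => [|k IH]; first by rewrite perm1 mul1r.
  by rewrite expgSr permM thg // IH mulrA -exprD mulnS.
have shift x k : exists a b, (g ^+ k)%g x = bshift (bshift x i a) j b.
  elim: k => [|k [a [b IH]]].
    by exists 0, 0; apply/ffunP => l; rewrite perm1 !ffunE !if_same !addr0.
  rewrite expgSr permM gE {}IH /brefl.
  set y := bshift _ j b; set s := bform y i; set t := bform _ j.
  exists (a - s), (b - t); apply/ffunP => l; rewrite !ffunE.
  by do 2!case: eqP => _ /=; ring.
apply/permP => x; rewrite perm1; have [a [b E]] := shift x r.
have hV0 : h^-1 != 0 by rewrite invr_eq0.
have fix_th d : d != 0 -> h + h^-1 = d + d^-1 -> d ^+ r = 1 ->
    th d ((g ^+ r)%g x) = th d x.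
  by move=> d0 Ed dr; rewrite thX // mulnC exprM dr expr1n mul1r.
have T1 := fix_th h h0 erefl hr.
have T2 : th h^-1 ((g ^+ r)%g x) = th h^-1 x.
  by apply: fix_th => //; [rewrite invrK addrC|rewrite exprVn hr invr1].
move: T1 T2; rewrite E /th !bform_shift cij cji !cii => T1 T2.
have hh : h - h^-1 != 0.
  apply: contra h21 => /eqP /subr0_eq H; rewrite expr2 {1}H mulVf //.
(* The displacement d = a e_i + b e_j is killed by both eigenforms. As h and h^-1 differ, B(d, e_i)
   = 0 here and B(d, e_j) = 0 in [E2]. *)
have E1 : a * 2%:R + b * (h + h^-1) = 0.
  apply: (mulfI hh); rewrite mulr0.
  move: T1 T2; set p := bform x i; set q := bform x j => T1 T2.
  have -> : (h - h^-1) * (a * 2%:R + b * (h + h^-1)) =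
    ((q + a * (h + h^-1) + b * 2%:R - h^-1 * (p + a * 2%:R + b * (h + h^-1))) - (q - h^-1 * p))
    - ((q + a * (h + h^-1) + b * 2%:R - h * (p + a * 2%:R + b * (h + h^-1))) - (q - h * p)) by ring.
  by rewrite T1 T2 !subrr.
have E2 : a * (h + h^-1) + b * 2%:R = 0.
  set p := bform x i in T1; set q := bform x j in T1.
  have -> : a * (h + h^-1) + b * 2%:R =
    (q + a * (h + h^-1) + b * 2%:R - h * (p + a * 2%:R + b * (h + h^-1))) - (q - h * p)
    + h * (a * 2%:R + b * (h + h^-1)) by ring.
  by rewrite T1 E1 subrr mulr0 addr0.
(* Up to sign, the determinant of the linear system [E1], [E2] in [a] and [b]. *)
have D : (h - h^-1) ^+ 2 = (h + h^-1) ^+ 2 - 4%:R by field.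
have D0 : (h - h^-1) ^+ 2 != 0 by rewrite expf_neq0.
have a0 : a = 0.
  apply: (mulfI D0); rewrite mulr0 D.
  have -> : ((h + h^-1) ^+ 2 - 4%:R) * a =
    (h + h^-1) * (a * (h + h^-1) + b * 2%:R) - 2%:R * (a * 2%:R + b * (h + h^-1)) by ring.
  by rewrite E1 E2 !mulr0 subrr.
have b0 : b = 0.
  apply: (mulfI D0); rewrite mulr0 D.
  have -> : ((h + h^-1) ^+ 2 - 4%:R) * b =
    (h + h^-1) * (a * 2%:R + b * (h + h^-1)) - 2%:R * (a * (h + h^-1) + b * 2%:R) by ring.
  by rewrite E1 E2 !mulr0 subrr.
by rewrite a0 b0; apply/ffunP => l; rewrite !ffunE !if_same !addr0.
Qed.

Lemma srefl_neq i j : 2%:R != 0 :> F -> i != j -> srefl i != srefl j.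
Proof.
(* On e_i the coordinate at [i] becomes -1 under [srefl i] but stays 1 under [srefl j]. *)
move=> two0 ij; apply/eqP => /permP /(_ [ffun l => (l == i)%:R]).
rewrite !permE => /ffunP /(_ i); rewrite !ffunE eqxx (negbTE ij) addr0 /bform.
rewrite (bigD1 i) //= big1 => [|l /negbTE li]; last by rewrite ffunE li mul0r.
rewrite ffunE eqxx mul1r addr0 cii => /eqP; rewrite -subr_eq0 addrAC subrr add0r oppr_eq0.
by rewrite (negbTE two0).
Qed.

End Reflections.

(** By Euler, [L] divides l^phi(L) - 1 for a prime l > max(2, L), so the field of order l^phi(L) has
    roots of unity of every prime order q dividing [L]. For [r] take q = [pdiv r]: it is odd, so h^2
    != 1. *)
Lemma roots_of_unity_field (L : nat) : odd L ->
  exists2 F : finFieldType, (2%:R != 0 :> F)%R &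
    forall r, r %| L -> 1 < r ->
      exists h : F, [&& h != 0, h ^+ 2 != 1 & h ^+ r == 1]%R.
Proof.
move=> oL; have L0 : 0 < L by case: L oL.
have [l lL pl] := prime_above (maxn 2 L).
have k0 : 0 < totient L by rewrite totient_gt0.
have [F charF cardF] := pPrimePowerField pl k0.
exists F.
  rewrite -(dvdn_pcharf charF); apply/negP => /(dvdn_leq (isT : 0 < 2)).
  by rewrite leqNgt (leq_ltn_trans (leq_maxl 2 L) lL).
move=> r rL r1; set q := pdiv r.
have pq : prime q by apply: pdiv_prime.
have qr : q %| r by apply: pdiv_dvd.
have oq : odd q by apply: dvdn_odd (dvdn_trans qr rL) oL.
have qdvd : q %| #|[set: {unit F}]%G|.
  rewrite card_finField_unit cardF; apply: dvdn_trans (dvdn_trans qr rL) _.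
  have cop : coprime l L.
    rewrite prime_coprime //; apply/negP => /(dvdn_leq L0).
    by rewrite leqNgt (leq_ltn_trans (leq_maxr 2 L) lL).
  have := Euler_exp_totient cop => /eqP.
  by rewrite eqn_mod_dvd ?expn_gt0 ?prime_gt0 // subn1.
have [u _ ou] := Cauchy pq qdvd.
have uX k : (val u ^+ k = 1)%R -> q %| k.
  rewrite -[in (val u ^+ k)%R]FinRing.val_unitX -[1%R]/(val (1%g : {unit F})) => /val_inj E.
  by rewrite -ou order_dvdn E.
exists (val u); apply/and3P; split.
- by rewrite -unitfE; exact: valP u.
- apply/eqP => /uX /(dvdn_leq (isT : 0 < 2)) q2; have := prime_gt1 pq => q1.
  have E : q = 2 by apply/eqP; rewrite eqn_leq q2.
  by rewrite E in oq.
- rewrite -FinRing.val_unitX; apply/eqP.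
  by have /dvdnP [d ->] := qr; rewrite mulnC expgM -ou expg_order expg1n.
Qed.

(* Only the odd labels matter: generators with an even label are made to commute. *)
Lemma odd_label_separation (n : nat) (m : 'I_n -> 'I_n -> nat) :
  (forall i j, m i j = m j i) -> (forall i j, is_edge m i j -> 1 < m i j) ->
  exists (gT : finGroupType) (h : 'I_n -> gT), respects m h /\ injective h.
Proof.
move=> msym m2.
pose L := \prod_(ij : 'I_n * 'I_n | odd (m ij.1 ij.2)) m ij.1 ij.2.
have oL : odd L by apply: (big_ind (fun x => odd x)) => // x y; rewrite oddM => ->.
have [F two0 HF] := roots_of_unity_field oL.
(* The default 1 never occurs at an odd edge label, by [rootP]. *)
pose root r := odflt 1%R [pick h : F | [&& h != 0, h ^+ 2 != 1 & h ^+ r == 1]%R].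
have rootP i j : is_edge m i j -> odd (m i j) ->
    [&& root (m i j) != 0, root (m i j) ^+ 2 != 1 & root (m i j) ^+ m i j == 1]%R.
  move=> e o; rewrite /root; case: pickP => [//|no].
  have mL : m i j %| L by rewrite /L (bigD1 (i, j)) //= dvdn_mulr.
  by have [h] := HF _ mL (m2 _ _ e); rewrite no.
pose c i j : F := (if i == j then 2%:R else
  if odd (m i j) then root (m i j) + (root (m i j))^-1 else 0)%R.
have cii i : c i i = 2%:R%R by rewrite /c eqxx.
have csym i j : c i j = c j i by rewrite /c eq_sym msym.
exists {perm {ffun 'I_n -> F}}, (srefl cii); split; last first.
  by move=> i j; apply: contra_eq; apply: srefl_neq.
apply/respectsP; split=> [i|i j e]; first exact: srefl_sq.
have ij : i != j by case/andP: (e).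
have [o|ev] := boolP (odd (m i j)).
  have /and3P [h0 h1 /eqP hm] := rootP _ _ e o.
  by apply: (srefl_rotation cii csym ij h0 h1 hm); rewrite /c (negbTE ij) o.
rewrite -(even_halfK ev) -mul2n expgM (srefl_commute cii csym ij) ?expg1n //.
by rewrite /c (negbTE ij) (negbTE ev).
Qed.

(** * Rigidity *)

Lemma map_alt_word (n n' : nat) (s : 'I_n -> 'I_n') i j k :
  map s (alt_word i j k) = alt_word (s i) (s j) k.
Proof. by elim: k => //= k IH; rewrite -[RHS]/[:: s i, s j & alt_word _ _ k] -IH. Qed.

Lemma map_cox_eq (n : nat) (m : 'I_n -> 'I_n -> nat) (n' : nat)
    (m' : 'I_n' -> 'I_n' -> nat) (s : 'I_n -> 'I_n') :
  (forall i j, is_edge m i j -> is_edge m' (s i) (s j) /\ m' (s i) (s j) = m i j) ->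
  forall u v, cox_eq m u v -> cox_eq m' (map s u) (map s v).
Proof.
move=> H u v; elim=> {u v} /=.
- by move=> u; exact: cox_refl.
- by move=> u v _; exact: cox_sym.
- by move=> u v w _ + _; exact: cox_trans.
- by move=> a b u v _ IH; rewrite !map_cat; exact: cox_ctx.
- by move=> i; exact: cox_sq.
- by move=> i j /H [e <-]; rewrite map_alt_word; exact: cox_edge.
Qed.

Lemma cox_iso (n : nat) (m : 'I_n -> 'I_n -> nat) (n' : nat)
    (m' : 'I_n' -> 'I_n' -> nat) (p : 'I_n' -> 'I_n) (q : 'I_n -> 'I_n') :
  cancel p q -> cancel q p ->
  (forall i j, is_edge m' i j = is_edge m (p i) (p j)) ->
  (forall i j, is_edge m' i j -> m' i j = m (p i) (p j)) ->
  group_iso (W m') (W m).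
Proof.
move=> pK qK He Hm; exists (map p), (map q); split; [|split; [|split; [|split]]] => /=.
- by apply: map_cox_eq => i j e; rewrite -He (Hm _ _ e).
- apply: map_cox_eq => i j e; have e' : is_edge m' (q i) (q j) by rewrite He !qK.
  by rewrite (Hm _ _ e') !qK.
- by move=> x y; rewrite map_cat; exact: cox_refl.
- by move=> x; rewrite (mapK pK); exact: cox_refl.
- by move=> y; rewrite (mapK qK); exact: cox_refl.
Qed.

Theorem theorem9p6 (n : nat) (m : 'I_n -> 'I_n -> nat)
  (Hm : coxeter_graph m)
  (H4 : forall i j : 'I_n, is_edge m i j -> (4 %| m i j)%N)
  (n' : nat) (m' : 'I_n' -> 'I_n' -> nat) (Hm' : coxeter_graph m') :
  profinite_iso (W m') (W m) -> group_iso (W m') (W m).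
Proof.
move=> /profinite_iso_transfer [S [T [Str Ttr SK TK]]].
have [msym _] := Hm; have [msym' m2'] := Hm'.
have [p [Sp psurj]] := class_map msym H4 Str Ttr SK TK.
have dvd := transfer_dvd msym H4 Str Ttr SK TK Sp.
have factor := class_map_factor msym H4 Str Ttr SK TK Sp psurj.
have lab2 i j : is_edge m' i j -> 1 < m' i j by case/andP => ij; exact: m2'.
(* A morphism that separates the generators of [W m'] factors through [p]. *)
have pinj : injective p.
  have [gT [h [Hh hinj]]] := odd_label_separation msym' lab2.
  by have [f _ E] := factor _ _ Hh => i j pij; apply: hinj; rewrite E /= pij.
have /fin_all_exists [q qK] := psurj.
have pK : cancel p q by move=> i; apply: pinj; rewrite qK.
have even' i j : is_edge m' i j -> ~~ odd (m' i j).
  move=> e; have ij : i != j by case/andP: e.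
  have [] := dvd i j _ e; first by rewrite (inj_eq pinj).
  move=> /H4 d4 /(dvdn_trans d4) d4'.
  by rewrite -dvdn2; apply: dvdn_trans d4'.
(* The dihedral quotient of [W m'] at [i], [j] factors through [p], so its rotation of order [k.+1]
   satisfies the relation of the edge between [p i] and [p j]. *)
have dihedral k i j : i != j -> (is_edge m' i j -> k.+1 %| m' i j) ->
    is_edge m (p i) (p j) -> k.+1 %| m (p i) (p j).
  move=> ij kd e; have Hd := dih_pair_respects msym' even' kd.
  have [f /respectsP [_ /(_ _ _ e) fe] E] := factor _ _ Hd.
  have fp u : f (p u) = dih_pair k i j u by rewrite E.
  move: fe; rewrite !fp /dih_pair eqxx eq_sym (negbTE ij) eqxx dihM dih_rotX => /(congr1 snd) /eqP.
  by rewrite /= oppr0 add0r ord_mulrn_eq0 /= /dvdn modnMml mul1n.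
apply: (cox_iso pK qK) => i j; last first.
  move=> e; have ij : i != j by case/andP: e.
  have pij : p i != p j by rewrite (inj_eq pinj).
  have [e2 d] := dvd _ _ pij e.
  apply/eqP; rewrite eqn_dvd d andbT.
  have := @dihedral (m' i j).-1 i j ij; rewrite prednK ?(ltnW (lab2 _ _ e)) //.
  by move=> -> //; move=> _; exact: dvdnn.
apply/idP/idP => e.
  by have [] := dvd i j _ e => //; rewrite (inj_eq pinj); case/andP: e.
have pij : p i != p j by case/andP: e.
have mp : 0 < m (p i) (p j) by case/andP: e; rewrite lt0n.
have ij : i != j by apply: contraNneq pij => ->.
apply: contraT => ne.
(* Without an edge in [m'] any order is allowed, in particular one larger than the label. *)
have /(dvdn_leq mp) : (m (p i) (p j)).+1 %| m (p i) (p j).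
  by apply: dihedral => //; rewrite (negbTE ne).
by rewrite ltnn.
Qed.
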